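(* Let $n \in \mathbb{N}$, $c \in \mathbb{R}^n$, $Q \subseteq \mathbb{R}^n$, and let $\gamma^* := \min_{x \in Q} c^T x$. Assume that $\gamma^* > -\infty$. Let $\mathscr{S} \subseteq 2^{\{1,\dots,n\}}$ be a family of index sets, and for each $S \in \mathscr{S}$ let $P_S \subseteq \mathbb{R}^{S}$ be a set with $P_S \supseteq \mathrm{Proj}_S(Q)$. Then for any set $R \subseteq \mathbb{R}^n$ with $R \supseteq Q$, $$\gamma^* \;\geq\; \omega(\mathscr{S},\{P_S\}_{S\in\mathscr{S}},R),$$ where $$\omega(\mathscr{S},\{P_S\}_{S\in\mathscr{S}},R) := \min\left\{ c^T x \;:\; x \in R,\; c_S^T x_S \geq \gamma(S,P_S)\ \ \forall S \in \mathscr{S}\right\}.$$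
   Context: For $u \in \mathbb{R}^n$ and $S \subseteq \{1,\dots,n\}$, $u_S \in \mathbb{R}^{S}$ denotes the subvector of $u$ indexed by $S$, and $\mathrm{Proj}_S(Q) := \{x_S : x \in Q\}$. For $S \subseteq \{1,\dots,n\}$ and $P_S \subseteq \mathbb{R}^S$, $\gamma(S,P_S) := \min_{x_S \in P_S} c_S^T x_S$. All optimal values (''min'') are understood as infima in $\mathbb{R}\cup\{\pm\infty\}$, with the convention that the minimum over the empty set is $+\infty$. *)

(* Defs.v *)
From HB Require Import structures.
From mathcomp Require Import all_boot all_order all_algebra.
From mathcomp Require Import all_classical all_reals ereal.

Set Implicit Arguments.
Unset Strict Implicit.
Unset Printing Implicit Defensive.

Import Order.TTheory GRing.Theory Num.Theory.

Local Open Scope classical_set_scope.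
Local Open Scope ring_scope.

(* R^I for a finite index type I is {ffun I -> R}: R^n is {ffun 'I_n -> R}, and
   R^S, for S a subset of the indices, is {ffun {i | i \in S} -> R}. *)
Definition dotp (R : realType) (I : finType) (u v : {ffun I -> R}) : R :=
  \sum_(i : I) u i * v i.

Definition subvec (R : realType) (n : nat) (S : {set 'I_n})
    (u : {ffun 'I_n -> R}) : {ffun {i : 'I_n | i \in S} -> R} :=
  [ffun i => u (val i)].

Definition Proj (R : realType) (n : nat) (S : {set 'I_n})
    (Q : set {ffun 'I_n -> R}) : set {ffun {i : 'I_n | i \in S} -> R} :=
  [set subvec S x | x in Q].
Arguments Proj {R n} S Q.

(* Optimal values live in \bar R; ereal_inf set0 = +oo. *)
Definition minval (R : realType) (I : finType) (c : {ffun I -> R})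
    (A : set {ffun I -> R}) : \bar R :=
  ereal_inf [set (dotp c x)%:E | x in A].

Definition gamma (R : realType) (n : nat) (c : {ffun 'I_n -> R})
    (S : {set 'I_n}) (PS : set {ffun {i : 'I_n | i \in S} -> R}) : \bar R :=
  minval (subvec S c) PS.
Arguments gamma {R n} c S PS.

Definition omega (R : realType) (n : nat) (c : {ffun 'I_n -> R})
    (F : {set {set 'I_n}})
    (P : forall S : {set 'I_n}, set {ffun {i : 'I_n | i \in S} -> R})
    (X : set {ffun 'I_n -> R}) : \bar R :=
  minval c [set x | X x /\ forall S : {set 'I_n}, S \in F ->
    (gamma c S (P S) <= (dotp (subvec S c) (subvec S x))%:E)%E].

(* Main.v *)
Require Import Defs.
From HB Require Import structures.
From mathcomp Require Import all_boot all_order all_algebra.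
From mathcomp Require Import all_classical all_reals ereal.

Set Implicit Arguments.
Unset Strict Implicit.
Unset Printing Implicit Defensive.

Import Order.TTheory GRing.Theory Num.Theory.

Local Open Scope classical_set_scope.
Local Open Scope ring_scope.

Theorem theorem2p2 (R : realType) (n : nat) (c : {ffun 'I_n -> R})
    (Q : set {ffun 'I_n -> R})
    (hgamma : (-oo < minval c Q)%E)
    (F : {set {set 'I_n}})
    (P : forall S : {set 'I_n}, set {ffun {i : 'I_n | i \in S} -> R})
    (hP : forall S : {set 'I_n}, S \in F -> Proj S Q `<=` P S)
    (X : set {ffun 'I_n -> R}) (hX : Q `<=` X) :
  (omega c F P X <= minval c Q)%E.
Proof.
(* The problem defining [omega] relaxes minimization over [Q]: every [x] in [Q] is feasible for it,
   and an infimum over a larger set can only be smaller or equal. *)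
apply: ereal_inf_le_tmp; apply: image_subset => x Qx; split; first exact: hX.
(* The cut for [S] holds at [x] because [subvec S x] lies in [Proj S Q], hence in [P S], so its cost
   is among the values whose infimum is [gamma c S (P S)]. *)
move=> S SF; apply: ereal_inf_lbound.
by exists (subvec S x) => //; apply: (hP S SF); exists x.
Qed.
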